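(* Let $(X,d)$ and $(Y,\rho)$ be compact metric spaces, $\boldsymbol f=\{f_i\}_{i=1}^\infty$ an equicontinuous sequence of maps from $X$ into itself, and $\boldsymbol g=\{g_i\}_{i=1}^\infty$ an equicontinuous sequence of maps from $Y$ into itself. If $\pi$ is a (time-independent) semiconjugacy from $(X,\boldsymbol f)$ to $(Y,\boldsymbol g)$, i.e. $\pi:X\to Y$ is a continuous surjection with $\pi\circ f_i=g_i\circ\pi$ for all $i\ge1$, then for every nonempty $Z\subseteq X$, every $\theta\in[0,1]$ and every $\varphi\in C(Y,\mathbb R)$ we have $$\underline P(\boldsymbol f,Z,\varphi\circ\pi,\theta)\le\underline P(\boldsymbol g,\pi(Z),\varphi,\theta)+\sup_{y\in Y}H\bigl(\boldsymbol f;\pi^{-1}(y)\bigr),$$ $$\overline P(\boldsymbol f,Z,\varphi\circ\pi,\theta)\le\overline P(\boldsymbol g,\pi(Z),\varphi,\theta)+\sup_{y\in Y}H\bigl(\boldsymbol f;\pi^{-1}(y)\bigr),$$ where $\underline P,\overline P$ are the lower and upper $\theta$-intermediate topological pressures and $H(\boldsymbol f;\cdot)$ is the topological sup-entropy.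
   Context: Pressures and entropies take values in $[-\infty,+\infty]$. $C(Y,\mathbb R)$ is the space of continuous real functions on $Y$. For a sequence $\boldsymbol f=\{f_i\}_{i\ge1}$ of continuous self-maps of a compact metric space put $f_i^0=\mathrm{id}_X$, $f_i^n=f_{i+n-1}\circ\cdots\circ f_i$, and $S_n\varphi(x)=\sum_{j=0}^{n-1}\varphi(f_1^j x)$. Topological sup-entropy. For $n\ge1$ let $d_n^*(x,y)=\sup_{i\ge1}\max_{0\le j<n}d(f_i^j(x),f_i^j(y))$. For nonempty $Z\subseteq X$, a set $F^*\subseteq X$ is an $(n,\varepsilon)^*$-spanning set of $Z$ if for every $x\in Z$ there is $y\in F^*$ with $d_n^*(x,y)\le\varepsilon$; a set $E^*$ is $(n,\varepsilon)^*$-separated if $d_n^*(x,y)>\varepsilon$ for distinct $x,y\in E^*$. Let $r_n^*(\boldsymbol f;Z;\varepsilon)$ be the minimal cardinality of an $(n,\varepsilon)^*$-spanning set of $Z$ and $s_n^*(\boldsymbol f;Z;\varepsilon)$ the maximal cardinality of an $(n,\varepsilon)^*$-separated subset of $Z$. Then $$H(\boldsymbol f;Z)=\lim_{\varepsilon\to0}\limsup_{n\to\infty}\frac1n\log r_n^*(\boldsymbol f;Z;\varepsilon)=\lim_{\varepsilon\to0}\limsup_{n\to\infty}\frac1n\log s_n^*(\boldsymbol f;Z;\varepsilon).$$ Pressures (for $(X,\boldsymbol f)$ and continuous $\varphi:X\to\mathbb R$; likewise for $(Y,\boldsymbol g)$). For a finite open cover $\mathcal U$ of $X$, $\mathcal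 S_m(\mathcal U)$ is the set of strings $\mathbf U=(U_0,\dots,U_{m-1})$ with all $U_j\in\mathcal U$; $m(\mathbf U)=m$ is the length of $\mathbf U$; and $X(\mathbf U)=\{x\in X: f_1^j(x)\in U_j,\ 0\le j\le m-1\}$. For $Z\subseteq X$, $\alpha\in\mathbb R$, $N\in\mathbb N$, $\theta\in[0,1]$ let $$M(Z,\alpha,\varphi,\mathcal U,N,\theta)=\inf_{\mathcal G}\sum_{\mathbf U\in\mathcal G}\exp\Bigl(-\alpha m(\mathbf U)+\sup_{x\in X(\mathbf U)}S_{m(\mathbf U)}\varphi(x)\Bigr),$$ the infimum over all finite or countable collections $\mathcal G$ of strings of lengths $m$ with $N\le m<N/\theta+1$ (for $\theta=0$: $m\ge N$) such that $Z\subseteq\bigcup_{\mathbf U\in\mathcal G}X(\mathbf U)$; the supremum over an empty $X(\mathbf U)$ is $-\infty$ (so the term is $0$). Let $\underline m$ and $\overline m$ be the $\liminf$ and $\limsup$ of $M(Z,\alpha,\varphi,\mathcal U,N,\theta)$ as $N\to\infty$, and $$\underline P(\boldsymbol f,Z,\varphi,\mathcal U,\theta)=\inf\{\alpha:\underline m=0\}=\sup\{\alpha:\underline m=\infty\},\quad \overline P(\boldsymbol f,Z,\varphi,\mathcal U,\theta)=\inf\{\alpha:\overline m=0\}=\sup\{\alpha:\overline m=\infty\}.$$ With $|\mathcal U|=\max_{U\in\mathcal U}\operatorname{diam}U$, the lower and upper $\theta$-intermediate topological pressures are $\underline P(\boldsymbol f,Z,\varphi,\theta)=\lim_{|\mathcal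 U|\to0}\underline P(\boldsymbol f,Z,\varphi,\mathcal U,\theta)$ and $\overline P(\boldsymbol f,Z,\varphi,\theta)=\lim_{|\mathcal U|\to0}\overline P(\boldsymbol f,Z,\varphi,\mathcal U,\theta)$ (these limits exist). *)

(* Defs.v *)
From HB Require Import structures.
From mathcomp Require Import all_boot all_order all_algebra finmap.
From mathcomp Require Import boolp classical_sets functions cardinality fsbigop.
From mathcomp Require Import reals ereal topology normedtype sequences realfun.
From mathcomp Require Import exp esum.

Set Implicit Arguments.
Unset Strict Implicit.
Unset Printing Implicit Defensive.

Import Order.TTheory GRing.Theory Num.Theory.
Import numFieldNormedType.Exports.

Local Open Scope classical_set_scope.
Local Open Scope ring_scope.
Local Open Scope ereal_scope.

(* Sequences of maps are indexed from 0: [f i] is the map written f_{i+1} in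
   the 1-based mathematical notation, and [comp_from f i n] is f_{i+1}^n. *)
Fixpoint comp_from (X : Type) (f : nat -> X -> X) (i n : nat) (x : X) : X :=
  if n is n'.+1 then f (i + n')%N (comp_from f i n' x) else x.

(* [equicontinuous setT f] of function_spaces, unfolded because the library
   version asks for a pointed codomain. *)
Definition equicontinuous_seq (R : realType) (X : metricType R)
    (f : nat -> X -> X) : Prop :=
  forall (x : X) (E : set (X * X)), entourage E ->
    \forall y \near x, forall i, E (f i x, f i y).

Definition semiconjugacy (R : realType) (X Y : metricType R)
    (f : nat -> X -> X) (g : nat -> Y -> Y) (p : X -> Y) : Prop :=
  [/\ continuous p, range p = [set: Y] & forall i, p \o f i = g i \o p].

Section SupEntropy.
Variables (R : realType) (X : metricType R) (f : nat -> X -> X).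

Definition dstar (n : nat) (x y : X) : \bar R :=
  ereal_sup (range (fun i : nat =>
    (\big[Num.max/0%R]_(j < n) mdist (comp_from f i j x) (comp_from f i j y))%:E)).

Definition spanning (n : nat) (e : R) (Z F : set X) : Prop :=
  forall x, Z x -> exists2 y, F y & dstar n x y <= e%:E.

(* +oo when there is no finite spanning set. *)
Definition rstar (Z : set X) (e : R) (n : nat) : \bar R :=
  ereal_inf [set (#|` F |%:R)%:E
            | F in [set F : {fset X} | spanning n e Z [set` F]]].

Definition sup_entropy (Z : set X) : \bar R :=
  lim (limn_esup (fun n => (n%:R^-1)%:E * lne (rstar Z e n))
         @[e --> (0 : R)^'+]).

End SupEntropy.

Section Covers.
Variables (R : realType) (X : metricType R).

Definition finite_open_cover (U : set (set X)) : Prop :=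
  [/\ finite_set U, (forall A, U A -> open A) & \bigcup_(A in U) A = [set: X]].

(* Here the empty set has diameter -oo; this does not affect the mesh of a
   cover of a nonempty space. *)
Definition diam (A : set X) : \bar R :=
  ereal_sup [set (mdist x y)%:E | x in A & y in A].

Definition mesh (U : set (set X)) : \bar R := ereal_sup [set diam A | A in U].

(* The filter of the limit |U| -> 0. *)
Definition mesh_to0 : set_system (set (set X)) :=
  filter_from [set e : R | (0 < e)%R]
    (fun e => [set U | finite_open_cover U /\ mesh U < e%:E]).

End Covers.

Section Pressure.
Variables (R : realType) (X : metricType R) (f : nat -> X -> X).

Definition birkhoff (phi : X -> R) (n : nat) (x : X) : R :=
  (\sum_(j < n) phi (comp_from f 0 j x))%R.

Definition strings (U : set (set X)) (N : nat) (theta : R) : set (seq (set X)) :=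
  [set s | [/\ (forall A, A \in s -> U A), (N <= size s)%N &
    theta = 0%R \/ ((size s)%:R < N%:R / theta + 1)%R]].

Definition cylinder (s : seq (set X)) : set X :=
  [set x | forall j, (j < size s)%N -> nth set0 s j (comp_from f 0 j x)].

(* [ereal_sup set0 = -oo] and [expeR -oo = 0], so strings with an empty
   cylinder have weight 0. *)
Definition weight (alpha : R) (phi : X -> R) (s : seq (set X)) : \bar R :=
  expeR ((- alpha * (size s)%:R)%:E +
         ereal_sup [set (birkhoff phi (size s) x)%:E | x in cylinder s]).

Definition Mfun (Z : set X) (alpha : R) (phi : X -> R) (U : set (set X))
    (N : nat) (theta : R) : \bar R :=
  ereal_inf [set \esum_(s in G) weight alpha phi s | G in
    [set G | [/\ countable G, G `<=` strings U N theta &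
                 Z `<=` \bigcup_(s in G) cylinder s]]].

Definition lower_pressure_cover (Z : set X) (phi : X -> R) (theta : R)
    (U : set (set X)) : \bar R :=
  ereal_inf [set alpha%:E | alpha in
    [set alpha | limn_einf (fun N => Mfun Z alpha phi U N theta) = 0]].

Definition upper_pressure_cover (Z : set X) (phi : X -> R) (theta : R)
    (U : set (set X)) : \bar R :=
  ereal_inf [set alpha%:E | alpha in
    [set alpha | limn_esup (fun N => Mfun Z alpha phi U N theta) = 0]].

Definition lower_pressure (Z : set X) (phi : X -> R) (theta : R) : \bar R :=
  lim (lower_pressure_cover Z phi theta U @[U --> @mesh_to0 R X]).

Definition upper_pressure (Z : set X) (phi : X -> R) (theta : R) : \bar R :=
  lim (upper_pressure_cover Z phi theta U @[U --> @mesh_to0 R X]).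

End Pressure.

(* Main.v *)
(* Bowen's argument. Let b exceed the fibre entropies. Every fibre of p, hence by
   compactness and equicontinuity every small set B of Y, comes with a block
   length m and at most exp(b m) points shadowing all orbit blocks that start in
   the preimage of B. Cutting a string of a fine cover of Y into such blocks
   replaces it by at most C exp(b n) strings of the same length n over a given
   cover of X. Lengths being preserved, the restriction on lengths given by
   theta plays no role and M(X, alpha + b + osc) <= C M(Y, alpha). The same
   estimate for the identity map, with b = 0, shows that the limits defining the
   pressures exist. *)
Require Import Defs.
From mathcomp Require Import all_boot all_order all_algebra finmap.
From mathcomp Require Import boolp classical_sets functions cardinality fsbigop.
From mathcomp Require Import reals ereal topology normedtype sequences realfun.
From mathcomp Require Import exp esum.
From mathcomp Require Import lra.
Import Order.TTheory GRing.Theory Num.Theory.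
Import numFieldNormedType.Exports.
Local Open Scope classical_set_scope.
Local Open Scope ring_scope.
Local Open Scope ereal_scope.

Set Implicit Arguments.
Unset Strict Implicit.
Unset Printing Implicit Defensive.

(** * Compactness in metric spaces: Lebesgue numbers, tubes around fibres, equicontinuity of
    iterates *)

Section CompactMetric.
Variable R : realType.
Implicit Types X Y : metricType R.

Lemma nbhs_mdist_lt X (x : X) (e : R) : (0 < e)%R ->
  \forall z \near x, (mdist x z < e)%R.
Proof. by move=> e0; apply/metricType_numDomainType.nbhs_mdistP; exists e. Qed.

Lemma mdist_split_lt X (x y z : X) (a b c : R) :
  (mdist x y < a)%R -> (mdist y z < b)%R -> (a + b <= c)%R -> (mdist x z < c)%R.
Proof.
move=> xy yz; apply: lt_le_trans.
by apply: le_lt_trans (metric_triangle x y z) _; rewrite ltrD.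
Qed.

(** The finite list [D] of centres is kept along with the Lebesgue number [d]: it later supplies
    finite covers and a common bound on block lengths. *)
Lemma finite_lebesgue_number X (W : X -> set X) :
  compact [set: X] -> (forall x, nbhs x (W x)) ->
  exists (d : R) (D : seq X), (0 < d)%R /\
    forall x, exists2 y, y \in D & forall z, (mdist x z < d)%R -> W y z.
Proof.
move=> /compact_near_coveringP cX nW.
pose P (i : R * seq X) (x : X) :=
  exists2 y, y \in i.2 & forall z, (mdist x z < i.1)%R -> W y z.
(* [S] is the filter of finite lists that contain any prescribed list. In its product with small
   positive radii, the near-covering form of compactness yields [d] and [D] at once. *)
pose S := filter_from setT (fun D : seq X => [set E : seq X | {subset D <= E}]).
have FS : ProperFilter S.
  apply: filter_from_proper; last by move=> D _; exists D.
  apply: filter_from_filter; first by exists [::].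
  move=> D E _ _; exists (D ++ E) => // G /= DEG.
  by split => x xD; apply: DEG; rewrite mem_cat xD ?orbT.
have [|[d D] /= [d0 HP]] := @filter_ex _ (filter_prod (0 : R)^'+ S) _
    [set i | (0 < i.1)%R /\ [set: X] `<=` P i].
  apply: filterI.
    near=> i; near: i.
    exists ([set r : R | (0 < r)%R], setT) => /=; last by case=> ? ? [].
    by split; [exact: nbhs_right_gt|exact: filterT].
  apply: (cX _ (filter_prod (0 : R)^'+ S) P) => x _.
  have /metricType_numDomainType.nbhs_mdistP[e e0 eW] := nW x.
  exists ([set x' | (mdist x x' < e / 2)%R],
          [set i : R * seq X | (i.1 < e / 2)%R /\ x \in i.2]) => /=.
    split; first by apply: nbhs_mdist_lt; rewrite divr_gt0.
    exists ([set r : R | (r < e / 2)%R], [set E : seq X | x \in E]) => //=.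
    split; first by apply: nbhs_right_lt; rewrite divr_gt0.
    by exists [:: x] => // E /= xE; apply: xE; rewrite mem_head.
  case=> x' [r E] /= [xx' [rd xE]]; exists x => //= z x'z; apply: eW => /=.
  by apply: mdist_split_lt xx' (lt_trans x'z rd) _; rewrite -splitr.
by exists d, D; split => // x; apply: HP.
Unshelve. all: by end_near. Qed.

Lemma lebesgue_number X (W : X -> set X) :
  compact [set: X] -> (forall x, nbhs x (W x)) ->
  exists2 d : R, (0 < d)%R &
    forall x, exists y, forall z, (mdist x z < d)%R -> W y z.
Proof.
move=> cX /(finite_lebesgue_number cX)[d [D [d0 H]]].
by exists d => // x; have [y ? ?] := H x; exists y.
Qed.

Lemma uniformly_continuous_compact X (h : X -> R) (e : R) :
  compact [set: X] -> continuous h -> (0 < e)%R ->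
  exists2 d : R, (0 < d)%R &
    forall x z, (mdist x z < d)%R -> (`|h x - h z| <= e)%R.
Proof.
move=> cX ch e0.
have [|d d0 H] := @lebesgue_number X (fun x z => `|h x - h z| < e / 2)%R cX.
  move=> x; have /cvgrPdist_lt := ch x; apply.
  by rewrite divr_gt0.
exists d => // x z xz; have [y Hy] := H x.
have /ltW h1 := Hy z xz; have /ltW h2 : (`|h y - h x| < e / 2)%R by apply: Hy; rewrite mdistxx.
rewrite (le_trans (ler_distD (h y) _ _))// (distrC (h x)).
by rewrite (le_trans (lerD h2 h1))// -splitr.
Qed.

(** Tube lemma: near a point of the fibre, [O] holds; near any other point, [p] stays away from [y]
    and the implication is vacuous. Compactness makes the neighbourhood of [y] uniform. *)
Lemma fiber_tube X Y (p : X -> Y) (y : Y) (O : set X) :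
  compact [set: X] -> continuous p ->
  (forall x, p x = y -> nbhs x O) ->
  \forall y' \near y, forall x, p x = y' -> O x.
Proof.
move=> /compact_near_coveringP cX cp nO.
suff H : \forall y' \near y, [set: X] `<=` (fun x => p x = y' -> O x).
  by apply: filterS H => y' H x; exact: H.
apply: (cX _ (nbhs y) (fun y' x => p x = y' -> O x)) => x _; have [pxy|/eqP pxy] := pselect (p x = y).
  exists (O, setT) => /=; first by split; [exact: nO|exact: filterT].
  by case=> x' y' [].
pose d := (mdist (p x) y / 2)%R; have d0 : (0 < d)%R by rewrite divr_gt0// mdist_gt0.
exists (p @^-1` [set z | mdist (p x) z < d]%R, [set z | mdist y z < d]%R) => /=.
  by split; [apply: cp|]; exact: nbhs_mdist_lt.
case=> x' y' /= [h1 h2] pE; rewrite pE in h1.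
rewrite metric_sym in h2.
by have := mdist_split_lt h1 h2 (lexx _); rewrite /d -splitr ltxx.
Qed.

(** Uniformity in the starting time [i] matters because [dstar] takes a supremum over it. By
    induction on [n], a Lebesgue number controls the last map uniformly. *)
Lemma equicontinuous_comp_from X (f : nat -> X -> X) (n : nat) (e : R) :
  compact [set: X] -> equicontinuous_seq f -> (0 < e)%R ->
  exists2 d : R, (0 < d)%R & forall x z, (mdist x z < d)%R ->
    forall i j, (j <= n)%N ->
      (mdist (comp_from f i j x) (comp_from f i j z) < e)%R.
Proof.
move=> cX ef; elim: n e => [|n IH] e e0.
  by exists e => // x z xz i j; rewrite leqn0 => /eqP ->.
have [|d1 d10 H1] := @lebesgue_number X
    (fun x z => forall i, (mdist (f i x) (f i z) < e / 2)%R) cX.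
  move=> x; apply: (ef x [set q | (mdist q.1 q.2 < e / 2)%R]).
  rewrite -entourage_ballE; exists (e / 2)%R => /=; first by rewrite divr_gt0.
  by case=> a b /=; rewrite ballEmdist.
(* [d1] serves the iterate [n.+1], [e] the earlier ones. *)
have [|d2 d20 H2] := IH (Num.min d1 e); first by rewrite lt_min d10.
exists d2 => // x z xz i j jn.
have {}H2 := H2 x z xz.
have [->|/negP/negP jn1] := eqVneq j n.+1; last first.
  have /(H2 i) : (j <= n)%N by rewrite -ltnS ltn_neqAle jn1.
  by rewrite lt_min => /andP[].
have := H2 i n (leqnn _); rewrite lt_min => /andP[h _] /=.
have [y Hy] := H1 (comp_from f i n x).
have h1 := Hy _ h (i + n)%N.
have h2 : (mdist (f (i + n)%N y) (f (i + n)%N (comp_from f i n x)) < e / 2)%R.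
  by apply: Hy; rewrite mdistxx.
rewrite metric_sym in h2.
by apply: mdist_split_lt h2 h1 _; rewrite -splitr.
Qed.

End CompactMetric.

(** * Finite open covers of small mesh *)

Section MeshFilter.
Variables (R : realType) (X : metricType R).
Hypothesis cX : compact [set: X].

(** Properness amounts to finite open covers of arbitrarily small mesh. Interiors of balls of radius
    [e / 3] have diameter at most [2e / 3], which leaves room for the strict bound. *)
Lemma mesh_to0_proper (x0 : X) : ProperFilter (@mesh_to0 R X).
Proof.
apply: filter_from_proper.
  apply: filter_from_filter; first by exists 1%R => /=.
  move=> a b /= a0 b0; exists (Num.min a b); first by rewrite /= lt_min a0.
  move=> U /= [cU mU]; split; split => //; apply: lt_le_trans mU _;
    by rewrite lee_fin ge_min lexx ?orbT.
move=> e /= e0.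
pose W (x : X) : set X := [set z | (mdist x z < e / 3)%R]^°.
have e3 : (0 < e / 3)%R by rewrite divr_gt0.
have nW x : nbhs x (W x) by apply: nbhs_interior; exact: nbhs_mdist_lt.
have [d [D [d0 HD]]] := finite_lebesgue_number cX nW.
exists (W @` [set` D]); split; first split.
- by apply: finite_image; exact: finite_seq.
- by move=> _ [x _ <-]; exact: open_interior.
- apply/seteqP; split => // x _; have [y yD yW] := HD x.
  by exists (W y); [exists y|apply: yW; rewrite mdistxx].
apply: (@le_lt_trans _ _ (e / 3 + e / 3)%:E); last by rewrite lte_fin; lra.
apply: ge_ereal_sup => _ [_ [y _ <-] <-].
apply: ge_ereal_sup => _ [x /interior_subset/= xW [z /interior_subset/= zW <-]].
by rewrite lee_fin ltW// (mdist_split_lt _ zW (lexx _))// metric_sym.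
Qed.

Lemma mesh_lt (U : set (set X)) (d : R) (A : set X) (x z : X) :
  mesh U < d%:E -> U A -> A x -> A z -> (mdist x z < d)%R.
Proof.
move=> mU UA Ax Az; rewrite -lte_fin; apply: le_lt_trans mU.
apply: le_ereal_sup_tmp; exists (diam A); first by exists A.
by apply: ereal_sup_ubound; exists x => //; exists z.
Qed.

End MeshFilter.

(** * Sums and limits in the extended reals *)

Section ExtendedReals.
Variable R : realType.

Lemma esum_bigcup_seq_le (I J : choiceType) (G : set I) (T : I -> seq J)
    (w : J -> \bar R) :
  (forall j, 0 <= w j) -> (forall i, uniq (T i)) ->
  \esum_(j in \bigcup_(i in G) [set` T i]) w j <=
  \esum_(i in G) \sum_(j <- T i) w j.
Proof.
move=> w0 uT; pose G' := \bigcup_(i in G) [set` T i].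
(* [h] selects one [i] for each [j] of the union, which embeds the union into the disjoint union of
   the [T i]. *)
have /choice[h hP] : forall j, exists oi, G' j ->
    exists2 i, oi = Some i & G i /\ j \in T i.
  move=> j; have [[i Gi ji]|nG] := pselect (G' j); last by exists None.
  by exists (Some i) => _; exists i.
rewrite (_ : \esum_(i in G) _ = \esum_(i in G) \esum_(j in [set` T i]) w j).
  rewrite esum_esum//.
  pose P := [set k : I * J | G' k.2 /\ h k.2 = Some k.1].
  rewrite (reindex_esum P G' snd); last first.
    split; first by move=> k [].
      move=> [i j] [i' j']; rewrite !inE /P/= => -[_ hj] [_ hj'] jj'.
      by move: hj; rewrite jj' hj' => -[<-].
    by move=> j Gj; have [i hj _] := hP j Gj; exists (i, j).
  apply: ereal_sup_le => _ [A [fA AP] <-]; exists A => //; split => //.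
  move=> [i j] /AP[/= Gj hj]; have [i' hj' [? ?]] := hP j Gj.
  by move: hj; rewrite hj' => -[<-].
apply: eq_esum => i _; rewrite esum_fset.
- exact: fsbig_seq.
- exact: finite_seq.
- by move=> j _; exact: w0.
Qed.

Lemma sum_le_size (J : eqType) (r : seq J) (w : J -> \bar R) (c : \bar R) :
  0 <= c -> (forall j, j \in r -> w j <= c) ->
  \sum_(j <- r) w j <= (size r)%:R%:E * c.
Proof.
move=> c0; elim: r => [|j r IH] wc; first by rewrite big_nil mul0e.
rewrite big_cons [size _]/= -add1n natrD EFinD ge0_muleDl// mul1e.
by rewrite leeD ?wc ?mem_head// IH// => k kr; rewrite wc// inE kr orbT.
Qed.

(** A one-sided Cauchy criterion. The limit is the lower limit [l] of [h] along [F]: the hypothesis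
    bounds [h] eventually by [l + eta], and the definition of [l] bounds it from below. Infinite [l]
    is allowed. *)
Lemma cvg_ereal_eventually_le (T : Type) (F : set_system T)
    (FF : ProperFilter F) (h : T -> \bar R) :
  (forall eta : R, (0 < eta)%R ->
    \forall u \near F, \forall v \near F, h u <= h v + eta%:E) ->
  cvg (h @ F).
Proof.
move=> H; pose l := ereal_sup [set ereal_inf (h @` V) | V in F].
have up (eta : R) : (0 < eta)%R -> \forall u \near F, h u <= l + eta%:E.
  move=> /H; apply: filterS => u Fu; rewrite -leeBlDr//.
  apply: le_ereal_sup_tmp; exists (ereal_inf (h @` [set v | h u <= h v + eta%:E])).
    by exists [set v | h u <= h v + eta%:E].
  by apply: le_ereal_inf_tmp => _ [v huv <-]; rewrite leeBlDr.
have low a : a < l -> \forall u \near F, a < h u.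
  move=> /ereal_sup_gt[_ [V FV <-] aV]; apply: filterS FV => u Vu.
  by apply: lt_le_trans aV _; apply: ereal_inf_lbound; exists u.
apply/cvg_ex; exists l; case: l up low => [r| |] up low.
- have near_r e : (0 < e)%R -> \forall u \near F, (r - e)%:E < h u <= (r + e)%:E.
    move=> e0; near=> u; apply/andP; split; last by near: u; exact: up.
    by near: u; apply: low; rewrite lte_fin ltrBlDr ltrDl.
  apply/fine_cvgP; split.
    apply: filterS (near_r 1%R ltr01) => u /andP[].
    by case: (h u).
  apply/cvgrPdist_le => e /near_r; apply: filterS => u /andP[] /=.
  case: (h u) => //= t; rewrite lte_fin lee_fin => rt tr.
  by rewrite ler_norml; apply/andP; split; lra.
- by apply/cvgeyPgt => A; apply: low; exact: ltry.
- apply/cvgeNyPle => A; apply: filterS (up 1%R ltr01) => u.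
  by rewrite addNye leeNy_eq => /eqP ->; exact: leNye.
Unshelve. all: by end_near. Qed.

(** The nested form lets the range of [v] depend on [u]: first [v] goes to its limit, then [u], then
    [eta] to 0. *)
Lemma lim_le_eventually (S T : Type) (F : set_system S) (G : set_system T)
    (FF : ProperFilter F) (FG : ProperFilter G)
    (h : S -> \bar R) (k : T -> \bar R) (b : R) :
  cvg (h @ F) -> cvg (k @ G) ->
  (forall eta : R, (0 < eta)%R ->
    \forall u \near F, \forall v \near G, h u <= k v + (b + eta)%:E) ->
  lim (h @ F) <= lim (k @ G) + b%:E.
Proof.
move=> ch ck H; apply/lee_addgt0Pr => eta /H Hu.
rewrite -addeA -EFinD; apply: lime_le => //; apply: filterS Hu => u Hv.
by rewrite -leeBlDr//; apply: lime_ge => //; apply: filterS Hv => v; rewrite leeBlDr.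
Qed.

(* Together with the bound [1 <= Lim u] for [1 <= u], this is all that the
   argument uses of liminf and limsup. *)
Definition dominates_zero (Lim : (nat -> \bar R) -> \bar R) :=
  forall (u v : nat -> \bar R) (C : R), (0 < C)%R -> (forall n, 0 <= u n) ->
    (forall n, u n <= C%:E * v n) -> Lim v = 0 -> Lim u = 0.

Lemma limn_einf_dominates_zero : dominates_zero (@limn_einf R).
Proof.
move=> u v C C0 u0 uv; rewrite !limn_einf_lim => v0.
apply/cvg_lim => //.
apply: (@squeeze_cvge _ _ _ _ (cst 0) _ (fun n => C%:E * einfs v n)).
- apply: nearW => n; apply/andP; split.
    by apply: le_ereal_inf_tmp => _ [k _ <-].
  rewrite -lee_pdivrMl//; apply: le_ereal_inf_tmp => _ [k kn <-].
  rewrite lee_pdivrMl//; apply: le_trans (uv k).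
  by apply: ereal_inf_lbound; exists k.
- exact: cvg_cst.
- rewrite -(mule0 C%:E) -v0; apply: cvgeZl => //; exact: is_cvg_einfs.
Qed.

Lemma limn_esup_dominates_zero : dominates_zero (@limn_esup R).
Proof.
move=> u v C C0 u0 uv; rewrite !limn_esup_lim => v0.
apply/cvg_lim => //.
apply: (@squeeze_cvge _ _ _ _ (cst 0) _ (fun n => C%:E * esups v n)).
- apply: nearW => n; apply/andP; split.
    by apply: le_ereal_sup_tmp; exists (u n) => //; exists n => /=.
  apply: ge_ereal_sup => _ [k kn <-]; apply: le_trans (uv k) _.
  by apply: lee_wpmul2l; [rewrite lee_fin ltW|apply: ereal_sup_ubound; exists k].
- exact: cvg_cst.
- rewrite -(mule0 C%:E) -v0; apply: cvgeZl => //; exact: is_cvg_esups.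
Qed.

Lemma limn_einf_ge1 (u : nat -> \bar R) : (forall n, 1 <= u n) -> 1 <= limn_einf u.
Proof.
move=> u1; rewrite limn_einf_lim; apply: lime_ge; first exact: is_cvg_einfs.
by apply: nearW => n; apply: le_ereal_inf_tmp => _ [k _ <-].
Qed.

Lemma limn_esup_ge1 (u : nat -> \bar R) : (forall n, 1 <= u n) -> 1 <= limn_esup u.
Proof. by move=> /limn_einf_ge1 /le_trans; apply; exact: limn_einf_sup. Qed.

End ExtendedReals.

(** * Replacing strings over a cover of Y by strings over a cover of X *)

Section Itineraries.
Variables (R : realType) (X Y : metricType R).
Variables (f : nat -> X -> X) (g : nat -> Y -> Y) (p : X -> Y).
Hypothesis semi : forall i, p \o f i = g i \o p.

Lemma comp_fromD i m n x :
  comp_from f i (m + n) x = comp_from f (i + m) n (comp_from f i m x).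
Proof. by elim: n => [|n IH]; rewrite ?addn0// addnS /= IH addnA. Qed.

Lemma semi_comp_from i n x : p (comp_from f i n x) = comp_from g i n (p x).
Proof.
elim: n => //= n <-.
by have /(congr1 (@^~ (comp_from f i n x))) := semi (i + n)%N.
Qed.

Lemma birkhoff_semi (phi : Y -> R) n x :
  birkhoff f (phi \o p) n x = birkhoff g phi n (p x).
Proof. by apply: eq_bigr => j _; rewrite /= semi_comp_from. Qed.

Variables (U : set (set X)) (V : set (set Y)) (A : X -> set X) (e b : R) (L : nat).
Hypothesis b0 : (0 <= b)%R.
Hypothesis UA : forall x, U (A x).
Hypothesis Ae : forall x z, (mdist x z < e)%R -> A x z.
Hypothesis traced : forall B, V B -> exists (m : nat) (F : seq X),
  [/\ (0 < m <= L)%N, ((size F)%:R <= expR (b * m%:R))%R &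
   forall x, B (p x) -> exists2 z, z \in F & forall i j, (j < m)%N ->
     (mdist (comp_from f i j z) (comp_from f i j x) < e)%R].

(* The greedy block decomposition: the first letter of [s] fixes a block length
   [m], the first [m] iterates are shadowed by one of at most [exp (b m)]
   points, and the rest of [s] is treated recursively from time [i + m]. *)
Lemma refine_string (s : seq (set Y)) (i : nat) :
  (forall B, B \in s -> V B) ->
  exists ts : seq (seq (set X)),
    [/\ forall t, t \in ts -> size t = size s /\ forall C, C \in t -> U C,
      ((size ts)%:R <= expR (b * (size s + L)%:R))%R &
      forall x,
        (forall j, (j < size s)%N -> nth set0 s j (p (comp_from f i j x))) ->
        exists2 t, t \in ts &
          forall j, (j < size t)%N -> nth set0 t j (comp_from f i j x)].
Proof.
have [n] := ubnP (size s); elim: n s i => // n IH [|B s] i sn sV.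
  exists [:: [::]]; split.
  - by move=> t; rewrite inE => /eqP ->.
  - by rewrite /= -expR0 ler_expR mulr_ge0.
  - by move=> x _; exists [::].
have [m [F [/andP[m0 mL] Fb Fm]]] := traced (sV B (mem_head _ _)).
(* Since [A] at a point contains its [e]-ball, the itinerary of a shadowing point [z], read through
   [A], is also one for every point that [z] shadows. *)
pose blk k z := mkseq (fun j => A (comp_from f i j z)) k.
have blkU k z C : C \in blk k z -> U C by move=> /mapP[j _ ->].
(* The last block may overrun the string and is truncated. Its count [exp (b m)] is paid for by the
   surplus [L] in the exponent, which the recursion passes on unspent. *)
have [sm|ms] := leqP (size s).+1 m.
  exists [seq blk (size s).+1 z | z <- F]; split.
  - by move=> t /mapP[z _ ->]; rewrite size_mkseq; split => // C /blkU.
  - rewrite size_map (le_trans Fb)// ler_expR ler_wpM2l// ler_nat.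
    by rewrite (leq_trans mL)// leq_addl.
  - move=> x xs; have [z zF zm] := Fm x (xs 0%N isT).
    exists (blk (size s).+1 z); first exact: map_f.
    move=> j; rewrite size_mkseq => js; rewrite nth_mkseq//; apply: Ae.
    by apply: zm; apply: leq_trans sm.
have dsz : size (drop m (B :: s)) = ((size s).+1 - m)%N by rewrite size_drop.
have [||ts [tsU tsb tsx]] := IH (drop m (B :: s)) (i + m)%N.
- by rewrite ltnS in sn; rewrite (leq_trans _ sn)// dsz /= ltn_subrL m0.
- by move=> C /mem_drop; exact: sV.
exists [seq blk m z ++ t | z <- F, t <- ts]; split.
- move=> t /allpairsP[[z t'] [/= zF /tsU[st' Ut'] ->]].
  rewrite size_cat size_mkseq st' dsz subnKC ?(ltnW ms)//; split => // C.
  by rewrite mem_cat => /orP[/blkU|/Ut'].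
- rewrite size_allpairs natrM.
  apply: le_trans (ler_pM _ _ Fb tsb) _ => //.
  rewrite -expRD ler_expR -mulrDr ler_wpM2l// -natrD ler_nat dsz addnA subnKC//.
  exact: ltnW.
- move=> x xs; have [z zF zm] := Fm x (xs 0%N isT).
  have [|t tts tx] := tsx (comp_from f i m x).
    move=> j; rewrite dsz => jm; rewrite nth_drop -comp_fromD.
    by apply: xs; rewrite /= -ltn_subRL.
  exists (blk m z ++ t); first by apply/allpairsP; exists (z, t).
  move=> j; rewrite size_cat size_mkseq nth_cat size_mkseq => jmt.
  case: ltnP => jm; first by rewrite nth_mkseq//; apply: Ae; exact: zm.
  rewrite -{2}(subnKC jm) comp_fromD; apply: tx.
  by rewrite ltn_subLR.
Qed.

Variables (phi : Y -> R) (gam : R).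
Hypothesis osc : forall C, U C -> forall x z, C x -> C z ->
  (`|phi (p x) - phi (p z)| <= gam)%R.

Lemma birkhoff_osc (t : seq (set X)) x z :
  (forall C, C \in t -> U C) -> cylinder f t x -> cylinder f t z ->
  (birkhoff f (phi \o p) (size t) x <=
   birkhoff f (phi \o p) (size t) z + gam * (size t)%:R)%R.
Proof.
move=> tU tx tz; rewrite -lerBlDl /birkhoff -sumrB.
rewrite mulr_natr -[X in (_ <= _ *+ X)%R]card_ord -sumr_const ler_sum// => j _.
rewrite (le_trans (ler_norm _))//; apply: (osc (tU _ (mem_nth set0 (ltn_ord j)))).
  exact: tx.
exact: tz.
Qed.

(** The point [x] links the two suprema: over the cylinder of [t] the Birkhoff sums exceed the one
    at [x] by at most [gam] per step, and the latter is a term of the supremum over the cylinder of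
    [s]. The shift of [alpha] by [b] gives the exponential factor. *)
Lemma weight_refine (alpha : R) (s : seq (set Y)) (t : seq (set X)) x :
  (forall C, C \in t -> U C) -> size t = size s ->
  cylinder f t x -> cylinder g s (p x) ->
  weight f (alpha + b + gam) (phi \o p) t <=
  (expR (- b * (size s)%:R))%:E * weight g alpha phi s.
Proof.
move=> tU ts tx sx; rewrite /weight -[(expR _)%:E]/(expeR _%:E) -expeRD lee_expeR.
set S := ereal_sup [set _ | _ in cylinder g s].
have supS : ereal_sup [set (birkhoff f (phi \o p) (size t) z)%:E | z in cylinder f t]
    <= (gam * (size s)%:R)%:E + S.
  apply: ge_ereal_sup => _ [z tz <-].
  have := birkhoff_osc tU tz tx; rewrite -lee_fin => /le_trans; apply.
  rewrite EFinD addeC ts leeD2l//; apply: ereal_sup_ubound.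
  by exists (p x) => //; rewrite birkhoff_semi.
rewrite (le_trans (leeD2l _ supS))// !addeA -!EFinD ts leeD2r// lee_fin.
lra.
Qed.

(** At most [exp (b (n + L))] strings, each of weight at most [exp (- b n)] times that of [s]: the
    length [n] cancels, and the constant is the same for all [s]. *)
Lemma string_cover (alpha : R) (s : seq (set Y)) :
  (forall B, B \in s -> V B) ->
  exists ts : seq (seq (set X)),
    [/\ uniq ts, forall t, t \in ts -> size t = size s /\ forall C, C \in t -> U C,
      forall x, cylinder g s (p x) -> exists2 t, t \in ts & cylinder f t x &
      \sum_(t <- ts) weight f (alpha + b + gam) (phi \o p) t <=
      (expR (b * L%:R))%:E * weight g alpha phi s].
Proof.
move=> sV; have [ts [tsU tsb tsx]] := refine_string 0 sV.
(* Only strings whose cylinder meets the preimage of that of [s] are kept, since [weight_refine]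
   needs a common point. *)
pose good t := `[< exists2 x, cylinder f t x & cylinder g s (p x) >].
exists (undup [seq t <- ts | good t]); split.
- exact: undup_uniq.
- by move=> t; rewrite mem_undup mem_filter => /andP[_ /tsU].
- move=> x sx; have [|t tts tx] := tsx x.
    by move=> j js; rewrite semi_comp_from; exact: sx.
  exists t => //; rewrite mem_undup mem_filter tts andbT.
  by apply/asboolP; exists x.
set w := weight g alpha phi s.
have w0 : 0 <= w by exact: expeR_ge0.
have c0 : 0 <= (expR (- b * (size s)%:R))%:E * w by rewrite mule_ge0// lee_fin expR_ge0.
apply: le_trans (sum_le_size c0 _) _.
  move=> t; rewrite mem_undup mem_filter => /andP[/asboolP[x tx sx] /tsU[st tU]].
  exact: weight_refine tx sx.
apply: (@le_trans _ _ ((size ts)%:R%:E * ((expR (- b * (size s)%:R))%:E * w))).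
  rewrite lee_wpmul2r// lee_fin ler_nat (leq_trans (size_undup _))//.
  by rewrite size_filter count_size.
rewrite muleA -EFinM lee_wpmul2r// lee_fin.
apply: le_trans (ler_wpM2r (expR_ge0 _) tsb) _.
by rewrite -expRD ler_expR natrD; lra.
Qed.

(** An admissible family is refined string by string. Lengths are preserved, so the new family is
    admissible for the same [N] and [theta]. *)
Lemma Mfun_semi (Z : set X) (alpha theta : R) (N : nat) :
  Mfun f Z (alpha + b + gam) (phi \o p) U N theta <=
  (expR (b * L%:R))%:E * Mfun g (p @` Z) alpha phi V N theta.
Proof.
rewrite -lee_pdivrMl ?expR_gt0//.
apply: le_ereal_inf_tmp => _ [G [cG GV ZG] <-]; rewrite lee_pdivrMl ?expR_gt0//.
(* Off [G] the empty list is chosen, so that [uniq] holds for every [s], as [esum_bigcup_seq_le]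
   requires. *)
have /choice[T TP] : forall s, exists ts : seq (seq (set X)), uniq ts /\ (G s ->
  [/\ forall t, t \in ts -> size t = size s /\ forall C, C \in t -> U C,
      forall x, cylinder g s (p x) -> exists2 t, t \in ts & cylinder f t x &
      \sum_(t <- ts) weight f (alpha + b + gam) (phi \o p) t <=
      (expR (b * L%:R))%:E * weight g alpha phi s]).
  move=> s; have [Gs|nG] := pselect (G s); last by exists [::].
  have [sV _ _] := GV _ Gs.
  by have [ts []] := string_cover alpha sV; exists ts.
apply: (@le_trans _ _ (\esum_(t in \bigcup_(s in G) [set` T s])
    weight f (alpha + b + gam) (phi \o p) t)).
  apply: ereal_inf_lbound; exists (\bigcup_(s in G) [set` T s]) => //; split.
  - by apply: bigcup_countable => // s _; apply: finite_set_countable; exact: finite_seq.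
  - move=> t [s Gs /= tT]; have [_ /(_ Gs)[+ _ _]] := TP s.
    by move=> /(_ _ tT)[st tU]; have [_ Ns th] := GV _ Gs; split; rewrite ?st.
  - move=> x Zx; have [|s Gs sx] := ZG (p x); first by exists x.
    have [_ /(_ Gs)[_ + _]] := TP s.
    by move=> /(_ _ sx)[t tT tx]; exists t => //; exists s.
apply: le_trans (esum_bigcup_seq_le _ _ _) _.
- by move=> t; exact: expeR_ge0.
- by move=> s; have [] := TP s.
apply: (@le_trans _ _ (\esum_(s in G) ((expR (b * L%:R))%:E * weight g alpha phi s))).
  by apply: le_esum => s Gs; have [_ /(_ Gs)[]] := TP s.
apply: ge_ereal_sup => _ [A' [fA AG] <-].
rewrite -ge0_mule_fsumr; last by move=> s; exact: expeR_ge0.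
by rewrite lee_wpmul2l ?lee_fin ?expR_ge0//; apply: ereal_sup_ubound; exists A'.
Qed.

End Itineraries.

(** * From the entropy of fibres to shadowing of small sets *)

Section FiberEntropy.
Variables (R : realType) (X Y : metricType R) (f : nat -> X -> X).

Lemma dstar_le n x z (e : R) : dstar f n x z <= e%:E ->
  forall i j, (j < n)%N -> (mdist (comp_from f i j x) (comp_from f i j z) <= e)%R.
Proof.
move=> xz i j jn; rewrite -lee_fin; apply: le_trans xz.
apply: le_ereal_sup_tmp; eexists; first by exists i.
by rewrite lee_fin (le_bigmax _ _ (Ordinal jn)).
Qed.

Lemma dstar_refl_le n x (e : R) : (0 <= e)%R -> dstar f n x x <= e%:E.
Proof.
move=> e0; apply: ge_ereal_sup => _ [i _ <-]; rewrite lee_fin.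
by apply: bigmax_le => // j _; rewrite mdistxx.
Qed.

Lemma rstar_ge0 Z (e : R) n : 0 <= rstar f Z e n.
Proof. by apply: le_ereal_inf_tmp => _ [F _ <-]; rewrite lee_fin. Qed.

Lemma rstar_nonincreasing Z (e e' : R) n : (e <= e')%R ->
  rstar f Z e' n <= rstar f Z e n.
Proof.
move=> ee'; apply: ereal_inf_le_tmp => _ [F FZ <-]; exists F => // x /FZ[y Fy xy].
by exists y => //; rewrite (le_trans xy).
Qed.

Let rate Z (e : R) (n : nat) : \bar R := (n%:R^-1)%:E * lne (rstar f Z e n).

Let rate_nonincreasing Z (e e' : R) n : (e <= e')%R -> rate Z e' n <= rate Z e n.
Proof.
move=> ee'; apply: lee_wpmul2l; first by rewrite lee_fin invr_ge0.
by rewrite lee_lne ?rstar_nonincreasing// in_itv/= rstar_ge0 leey.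
Qed.

(** The rate grows as the scale shrinks, so the limit at [0] is a supremum over scales and bounds
    the upper limit at [e]. Some tail of rates at [e] then lies below [b], and one [m] is taken from
    it. *)
Lemma sup_entropy_spanning Z (b e : R) : sup_entropy f Z < b%:E -> (0 < e)%R ->
  exists m (F : {fset X}), [/\ (0 < m)%N, spanning f m e Z [set` F] &
    (#|` F |%:R <= expR (b * m%:R))%R].
Proof.
move=> Zb e0.
have rate_cvg := @nonincreasing_at_right_cvge R (fun e => limn_esup (rate Z e)) 0%R
  (BInfty _ false).
have /rate_cvg/(_ _)/cvg_lim limE : (BRight 0%R < BInfty R false)%O by [].
have {limE} sup_le : limn_esup (rate Z e) <= sup_entropy f Z.
  rewrite /sup_entropy limE//.
    by apply: ereal_sup_ubound; exists e => //=; rewrite in_itv/= e0.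
  move=> a c _ _ ac; rewrite !limn_esup_lim.
  apply: lee_lim; [exact: is_cvg_esups|exact: is_cvg_esups|].
  apply: nearW => n; apply: ge_ereal_sup => _ [k kn <-].
  apply: le_trans (rate_nonincreasing _ _ ac) _.
  by apply: ereal_sup_ubound; exists k.
have /ereal_inf_lt[_ [V [N _ NV] <-] Vb] := le_lt_trans sup_le Zb.
(* The successor makes [m] positive, so that the factor [1 / m] can be cleared. *)
pose m := N.+1; have mV : rate Z e m <= ereal_sup (rate Z e @` V).
  by apply: ereal_sup_ubound; exists m => //; apply: NV => /=.
move: (le_lt_trans mV Vb); rewrite /rate lte_pdivrMl// -EFinM => rb.
have : rstar f Z e m < (expR (m%:R * b))%:E.
  have /eqP <- : expeR (lne (rstar f Z e m)) == rstar f Z e m.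
    by rewrite lneK_eq rstar_ge0.
  by rewrite -[(expR _)%:E]/(expeR _%:E) lte_expeR.
move=> /ereal_inf_lt[_ [F FZ <-]]; rewrite lte_fin => Fb.
by exists m, F; split => //; rewrite mulrC ltW.
Qed.

Variable p : X -> Y.

(** A consequence of fibre entropies below [b] that keeps one block length per fibre and scale. For
    the identity it also holds with [b = 0], where the strict entropy bound fails on a nonempty
    space. *)
Definition fiber_bound (b : R) := forall (e : R) (y : Y), (0 < e)%R ->
  exists m (F : {fset X}), [/\ (0 < m)%N, spanning f m e (p @^-1` [set y]) [set` F] &
    (#|` F |%:R <= expR (b * m%:R))%R].

Lemma fiber_bound_sup_entropy (b : R) :
  ereal_sup (range (fun y : Y => sup_entropy f (p @^-1` [set y]))) < b%:E ->
  fiber_bound b.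
Proof.
move=> Hb e y e0; apply: sup_entropy_spanning => //; apply: le_lt_trans Hb.
by apply: ereal_sup_ubound; exists y.
Qed.

(** The fibre through [x] is nonempty, hence so is its spanning set, and [1 <= exp (b m)]. *)
Lemma fiber_bound_ge0 (b : R) (x : X) : fiber_bound b -> (0 <= b)%R.
Proof.
move=> /(_ 1%R (p x) ltr01)[m [F [m0 /(_ x erefl)[z zF _] Fb]]].
have : (1 <= expR (b * m%:R))%R.
  by rewrite (le_trans _ Fb)// ler1n cardfs_gt0; apply/fset0Pn; exists z.
by rewrite -[X in (X <= _)%R]expR0 ler_expR pmulr_lge0// ltr0n.
Qed.

(** Points spanning one fibre at scale [e / 3] shadow, by equicontinuity, a neighbourhood of that
    fibre, hence by [fiber_tube] the preimage of a neighbourhood of [y]. A Lebesgue number of these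
    neighbourhoods gives [d]. *)
Lemma fiber_bound_traced (b e : R) :
  compact [set: X] -> compact [set: Y] -> equicontinuous_seq f ->
  continuous p -> fiber_bound b -> (0 < e)%R ->
  exists (d : R) (L : nat), (0 < d)%R /\ forall B : set Y,
    (forall y z, B y -> B z -> (mdist y z < d)%R) ->
    exists (m : nat) (F : seq X),
    [/\ (0 < m <= L)%N, ((size F)%:R <= expR (b * m%:R))%R &
     forall x, B (p x) -> exists2 z, z \in F & forall i j, (j < m)%N ->
       (mdist (comp_from f i j z) (comp_from f i j x) < e)%R].
Proof.
move=> cX cY ef cp fb e0; have e3 : (0 < e / 3)%R by rewrite divr_gt0.
have /choice[mF mFP] : forall y, exists mF : nat * {fset X},
    [/\ (0 < mF.1)%N, spanning f mF.1 (e / 3)%R (p @^-1` [set y]) [set` mF.2] &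
    (#|` mF.2 |%:R <= expR (b * mF.1%:R))%R].
  by move=> y; have [m [F ?]] := fb _ y e3; exists (m, F).
pose O y : set X := [set x | exists2 z, z \in (mF y).2 & forall i j, (j < (mF y).1)%N ->
  (mdist (comp_from f i j z) (comp_from f i j x) < e)%R].
pose W y := [set y' | forall x, p x = y' -> O y x].
have nW y : nbhs y (W y).
  apply: fiber_tube => // x pxy; have [m0 Fy _] := mFP y.
  have [z zF /dstar_le xz] := Fy x pxy.
  have [d d0 xd] := equicontinuous_comp_from (mF y).1 cX ef e3.
  apply: filterS (nbhs_mdist_lt x d0) => x' /= xx'.
  exists z => // i j jm; have jm' := ltnW jm.
  have h1 := xd _ _ xx' i j jm'; have h2 := xz i j jm.
  rewrite metric_sym in h2.
  (* [dstar] gives a non-strict bound; one third of [e] is spent on making it strict. *)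
  have e23 : (e / 3 < e / 3 + e / 3)%R by rewrite ltrDl.
  by apply: mdist_split_lt (le_lt_trans h2 e23) h1 _; lra.
have [d [D [d0 DW]]] := finite_lebesgue_number cY nW.
(* The largest block length over the finite list; the successor leaves room for [m = 1] when [B] is
   empty. *)
exists d, (\max_(y <- D) (mF y).1).+1; split => // B Bd.
have [[y0 By0]|B0] := pselect (B !=set0); last first.
  exists 1%N, [::]; split => //; first by rewrite expR_ge0.
  by move=> x Bx; case: B0; exists (p x).
have [y yD yW] := DW y0; have [m0 _ Fb] := mFP y.
exists (mF y).1, (mF y).2; split => //.
- by rewrite m0 leqW//; apply: leq_bigmax_seq.
- by move=> x Bx; apply: (yW (p x)) => //; exact: Bd.
Qed.

End FiberEntropy.

Lemma fiber_bound_id (R : realType) (X : metricType R) (f : nat -> X -> X) :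
  fiber_bound f (@id X) 0.
Proof.
move=> e y e0; exists 1%N, [fset y]%fset; split => //.
  move=> x -> /=; exists y; first by rewrite inE.
  by apply: dstar_refl_le; exact: ltW.
by rewrite cardfs1 mul0r expR0.
Qed.

(** * Comparison of pressures relative to covers *)

Section Pressures.
Variables (R : realType) (Lim : (nat -> \bar R) -> \bar R).
Hypothesis Lim_dom : dominates_zero Lim.
Hypothesis Lim_ge1 : forall u, (forall n, 1 <= u n) -> 1 <= Lim u.

(** For [Lim] equal to [limn_einf] or [limn_esup] this unfolds to the lower or upper pressure of a
    cover, so one argument serves both inequalities. *)
Definition pressure_cover (X : metricType R) (f : nat -> X -> X) (Z : set X)
    (phi : X -> R) (theta : R) (U : set (set X)) : \bar R :=
  ereal_inf [set alpha%:E | alpha in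
    [set alpha | Lim (fun N => Mfun f Z alpha phi U N theta) = 0]].

(** A single string whose cylinder contains a point of [Z] already has weight at least 1: each step
    contributes [phi - alpha > 0] to the exponent at that point. *)
Lemma Mfun_ge1 (X : metricType R) (f : nat -> X -> X) (Z : set X) (phi : X -> R)
    (theta K alpha : R) (U : set (set X)) (N : nat) :
  Z !=set0 -> (forall x, `|phi x| <= K)%R -> (alpha < - K)%R ->
  1 <= Mfun f Z alpha phi U N theta.
Proof.
move=> [x Zx] phiK aK; apply: le_ereal_inf_tmp => _ [G [_ GU ZG] <-].
have [s Gs sx] := ZG x Zx.
apply: esum_ge; exists [set s].
  by split; [exact: finite_set1|move=> _ ->].
rewrite fsbig_set1 -expeR0 lee_expeR.
apply: (@le_trans _ _ ((- alpha * (size s)%:R)%:E + (birkhoff f phi (size s) x)%:E)).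
  rewrite -EFinD lee_fin -lerBlDr sub0r.
  rewrite /birkhoff -sumrN mulr_natr -[X in (_ <= _ *+ X)%R]card_ord -sumr_const.
  apply: ler_sum => j _; rewrite lerNl opprK.
  have := phiK (comp_from f 0 j x); rewrite ler_norml => /andP[+ _].
  by apply: le_trans; exact: ltW.
by rewrite leeD2l//; apply: ereal_sup_ubound; exists x.
Qed.

Lemma pressure_cover_ge (X : metricType R) (f : nat -> X -> X) (Z : set X)
    (phi : X -> R) (theta K : R) (U : set (set X)) :
  Z !=set0 -> (forall x, `|phi x| <= K)%R ->
  (- K)%:E <= pressure_cover f Z phi theta U.
Proof.
move=> Z0 phiK; apply: le_ereal_inf_tmp => _ [alpha /= aL <-].
rewrite lee_fin leNgt; apply/negP => aK.
have := Lim_ge1 (fun N => Mfun_ge1 f theta U N Z0 phiK aK).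
by rewrite aL leNgt lte01.
Qed.

Variables (X Y : metricType R) (f : nat -> X -> X) (g : nat -> Y -> Y) (p : X -> Y).

(** The order of choice dictates the nested quantifiers: the mesh of [U] controls the oscillation of
    [phi \o p], and the mesh of [V] is then chosen from a Lebesgue number of [U]. *)
Lemma pressure_cover_semi (Z : set X) (theta b eta : R) (phi : Y -> R) :
  compact [set: X] -> compact [set: Y] -> equicontinuous_seq f ->
  continuous p -> (forall i, p \o f i = g i \o p) -> continuous phi ->
  (0 <= b)%R -> fiber_bound f p b -> (0 < eta)%R ->
  \forall U \near @mesh_to0 R X, \forall V \near @mesh_to0 R Y,
    pressure_cover f Z (phi \o p) theta U <=
    pressure_cover g (p @` Z) phi theta V + (b + eta)%:E.
Proof.
move=> cX cY ef cp semi cphi b0 fb eta0.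
have cphip : continuous (phi \o p) by move=> x; apply: continuous_comp; [exact: cp|exact: cphi].
have [d d0 osc] := uniformly_continuous_compact cX cphip eta0.
exists d => // U [[_ oU covU] mU].
have /choice[W WP] : forall x, exists A, U A /\ A x.
  move=> x; have : [set: X] x by [].
  by rewrite -covU => -[A UA Ax]; exists A.
have [|e e0 We] := @lebesgue_number _ _ W cX.
  by move=> x; have [UW Wx] := WP x; apply: open_nbhs_nbhs; split => //; exact: oU.
(* [W (c x)] is a member of [U] containing the [e]-ball at [x]; [W \o c] will serve as the map [A]
   of [Mfun_semi]. *)
have /choice[c cP] := We.
have [d' [L [d'0 tr]]] := fiber_bound_traced cX cY ef cp fb e0.
exists d' => // V [_ mV].
rewrite -leeBlDr//; apply: le_ereal_inf_tmp => _ [alpha aL <-].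
rewrite leeBlDr// -EFinD; apply: ereal_inf_lbound; exists (alpha + (b + eta))%R => //=.
apply: (Lim_dom (expR_gt0 (b * L%:R)) _ _ aL) => N.
  apply: le_ereal_inf_tmp => _ [G _ <-]; apply: esum_ge0 => s _; exact: expeR_ge0.
rewrite addrA; apply: (@Mfun_semi _ _ _ _ _ _ semi U V (W \o c) e b L).
- exact: b0.
- by move=> x; have [] := WP (c x).
- exact: cP.
- by move=> B VB; apply: tr => y z By Bz; exact: mesh_lt mV VB By Bz.
- by move=> C UC x z Cx Cz; apply: osc; exact: mesh_lt mU UC Cx Cz.
Qed.

End Pressures.

(** * Letting the mesh tend to zero *)

Section Comparison.
Variables (R : realType) (Lim : (nat -> \bar R) -> \bar R).
Hypothesis Lim_dom : dominates_zero Lim.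
Hypothesis Lim_ge1 : forall u, (forall n, 1 <= u n) -> 1 <= Lim u.

Lemma is_cvg_pressure_cover (X : metricType R) (f : nat -> X -> X) (Z : set X)
    (theta : R) (phi : X -> R) (x0 : X) :
  compact [set: X] -> equicontinuous_seq f -> continuous phi ->
  cvg (pressure_cover Lim f Z phi theta U @[U --> @mesh_to0 R X]).
Proof.
move=> cX ef cphi; apply: cvg_ereal_eventually_le => [|eta eta0].
  exact: mesh_to0_proper.
have := @pressure_cover_semi _ _ Lim_dom X X f f id Z theta 0 eta phi cX cX ef
  (fun x => cvg_id) (fun i => erefl) cphi (lexx _) (@fiber_bound_id _ _ f) eta0.
by rewrite image_id add0r.
Qed.

Lemma lim_pressure_semi (X Y : metricType R) (f : nat -> X -> X) (g : nat -> Y -> Y)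
    (p : X -> Y) (Z : set X) (theta : R) (phi : Y -> R) :
  compact [set: X] -> compact [set: Y] -> equicontinuous_seq f ->
  equicontinuous_seq g -> semiconjugacy f g p -> Z !=set0 -> continuous phi ->
  lim (pressure_cover Lim f Z (phi \o p) theta U @[U --> @mesh_to0 R X]) <=
  lim (pressure_cover Lim g (p @` Z) phi theta V @[V --> @mesh_to0 R Y]) +
  ereal_sup (range (fun y : Y => sup_entropy f (p @^-1` [set y]))).
Proof.
move=> cX cY ef eg [cp _ semi] [x Zx] cphi.
have FX := mesh_to0_proper cX x; have FY := mesh_to0_proper cY (p x).
have cphip : continuous (phi \o p) by move=> z; apply: continuous_comp; [exact: cp|exact: cphi].
have cvX := @is_cvg_pressure_cover _ _ Z theta _ x cX ef cphip.
have cvY := @is_cvg_pressure_cover _ _ (p @` Z) theta _ (p x) cY eg cphi.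
set PX := lim _; set PY := lim _; set H := ereal_sup _.
have le_b (b : R) : H < b%:E -> (0 <= b)%R /\ PX <= PY + b%:E.
  move=> /fiber_bound_sup_entropy fb; have b0 := fiber_bound_ge0 x fb.
  split => //; apply: lim_le_eventually => // eta eta0.
  exact: pressure_cover_semi.
(* When [H] is [+oo] the right side must be [+oo], whereas [-oo + +oo] is [-oo]; boundedness of
   [phi] keeps [PY] away from [-oo]. *)
have PYNy : PY != -oo.
  have [K KP] : exists K : R, forall y, (`|phi y| <= K)%R.
    have : compact (range phi) by apply: continuous_compact => //; exact: continuous_subspaceT.
    move=> /compact_bounded/pinfty_ex_gt0[K _ HK].
    by exists K => y; apply: HK; exists y.
  rewrite -ltNye (lt_le_trans (ltNyr (- K)%R))//.
  apply: lime_ge => //; apply: nearW => V; apply: pressure_cover_ge => //.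
  by exists (p x), x.
(* A real [H] is approached by [b = H + e]; [H = -oo] is excluded because [b = -1] would have to be
   nonnegative. *)
case: H le_b => [r| |] le_b.
- apply/lee_addgt0Pr => e e0; rewrite -addeA -EFinD.
  by have [] := le_b (r + e)%R; rewrite ?lte_fin ?ltrDl.
- by rewrite addey ?leey.
- by have [] := le_b (-1)%R (ltNyr _); rewrite ler0N1.
Qed.

End Comparison.

Theorem theorem4p3 (R : realType) (X Y : metricType R)
    (f : nat -> X -> X) (g : nat -> Y -> Y) (p : X -> Y) :
  compact [set: X] -> compact [set: Y] ->
  equicontinuous_seq f -> equicontinuous_seq g ->
  semiconjugacy f g p ->
  forall (Z : set X) (theta : R) (phi : Y -> R),
    Z !=set0 -> (0 <= theta <= 1)%R -> continuous phi ->
    lower_pressure f Z (phi \o p) theta <=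
      lower_pressure g (p @` Z) phi theta +
      ereal_sup (range (fun y : Y => sup_entropy f (p @^-1` [set y])))
    /\
    upper_pressure f Z (phi \o p) theta <=
      upper_pressure g (p @` Z) phi theta +
      ereal_sup (range (fun y : Y => sup_entropy f (p @^-1` [set y]))).
Proof.
move=> cX cY ef eg semi Z theta phi Z0 _ cphi; split.
- exact: (lim_pressure_semi (@limn_einf_dominates_zero R) (@limn_einf_ge1 R)).
- exact: (lim_pressure_semi (@limn_esup_dominates_zero R) (@limn_esup_ge1 R)).
Qed.
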